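(* Let $U$ be a finite set and $\mathcal{O}\subseteq\mathcal{P}(U)$ an independent set of obligations. Let $X\subseteq U$ be nonempty and $\preceq_s$-closed. Then: (1) $X$ contains the best element (i.e. every best element of $U$). (2) $X\prec_{l,s}U\setminus X$. (3) $X$ is (ui). (4) $X\in\mathcal{D}(\mathcal{O})$. (5) $X$ is a neighbourhood, and an improving neighbourhood, of the set of best elements in $U$.
   Context: $U$ is a finite set, and $\mathcal{O}\subseteq\mathcal{P}(U)$ is a set of ''obligations''. For $\mathcal{O}'\subseteq\mathcal{O}$, $\delta:\mathcal{O}'\to\{0,1\}$ and $m\in U$, $m\models\delta$ iff for all $O\in\mathcal{O}'$: $m\in O\Leftrightarrow\delta(O)=1$. $\mathcal{O}$ is independent iff for every $\delta:\mathcal{O}\to\{0,1\}$ there is $m\in U$ with $m\models\delta$. For $x,y\in U$: - $\mathcal{O}(x):=\{O\in\mathcal{O}: x\in O\}$. - Quality (set variant; smaller means better): $x\preceq_s y$ iff $\mathcal{O}(y)\subseteq\mathcal{O}(x)$; $x\prec_s y$ iff $\mathcal{O}(y)\subsetneq\mathcal{O}(x)$. - Distance (set variant): $d_s(x,y):=\mathcal{O}(x)\,\triangle\,\mathcal{O}(y)$ (symmetric difference); distances are compared by inclusion. - $[x,z]_s:=\{y\in U: d_s(x,z)=d_s(x,y)\cup d_s(y,z)\}$. - A best element of $U$ is some $x\in U$ such that there is no $z\in U$ with $z\prec_s x$. - $X\subseteq U$ is $\preceq_s$-closed iff for all $x\in X$, $y\in U$: $y\preceq_s x$ implies $y\in X$.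 - An element $x'$ of a set $Y$ is closest to $x$ in $Y$ iff there is no $x''\in Y$ with $d_s(x,x'')\subsetneq d_s(x,x')$. Let $x\parallel Y$ be the set of elements of $Y$ closest to $x$. - $X\prec_{l,s}Y$ iff for all $x\in X$ and all $y\in x\parallel Y$ we have $x\prec_s y$, and for all $y\in Y$ and all $x\in y\parallel X$ we have $x\prec_s y$. - $X$ is (ui) (union of intersections) iff there is a family $(\mathcal{O}_i)_{i\in I}$ with $\mathcal{O}_i\subseteq\mathcal{O}$ and $X=\bigcup_{i\in I}\bigcap\mathcal{O}_i$, where $\bigcap\emptyset:=U$. - $X\in\mathcal{D}(\mathcal{O})$ iff for all $\mathcal{O}'\subseteq\mathcal{O}$, all $\delta:\mathcal{O}'\to\{0,1\}$ and all $m,m'\in U$ with $m,m'\models\delta$, $m\in X$, $m'\notin X$, there is $m''\in X$ with $m''\models\delta$ and $m''\prec_s m'$. - For $B\subseteq Y\subseteq U$: $Y$ is a neighbourhood of $B$ in $U$ iff for all $y\in Y$ and all $x\in B$ closest to $y$ in $B$, $[x,y]_s\subseteq Y$. $Y$ is an improving neighbourhood of $B$ in $U$ iff for all $y\in Y$ and all $x$ that are closest to $y$ in $\{x'\in B: x'\preceq_s y\}$, $[x,y]_s\subseteq Y$. (Both notions require $B\subseteq Y$.) *)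

(* Defs.v *)
From mathcomp Require Import all_boot.

Set Implicit Arguments.
Unset Strict Implicit.
Unset Printing Implicit Defensive.

(* An assignment [Os' -> {0,1}] is encoded as a total map [{set U} -> bool]
   of which only the values on [Os'] are ever consulted. *)
Definition models (U : finType) (Os' : {set {set U}})
    (delta : {set U} -> bool) (m : U) : Prop :=
  forall A : {set U}, A \in Os' -> (m \in A <-> delta A = true).

Definition independent (U : finType) (Os : {set {set U}}) : Prop :=
  forall delta : {set U} -> bool, exists m : U, models Os delta m.

Definition obl (U : finType) (Os : {set {set U}}) (x : U) : {set {set U}} :=
  [set A in Os | x \in A].

(* Smaller means better: the better element fulfils more obligations. *)
Definition qle (U : finType) (Os : {set {set U}}) (x y : U) : bool :=
  obl Os y \subset obl Os x.

Definition qlt (U : finType) (Os : {set {set U}}) (x y : U) : bool :=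
  obl Os y \proper obl Os x.

Definition dist (U : finType) (Os : {set {set U}}) (x y : U) : {set {set U}} :=
  (obl Os x :\: obl Os y) :|: (obl Os y :\: obl Os x).

Definition between (U : finType) (Os : {set {set U}}) (x z : U) : {set U} :=
  [set y | dist Os x z == dist Os x y :|: dist Os y z].

Definition best (U : finType) (Os : {set {set U}}) : {set U} :=
  [set x | ~~ [exists z : U, qlt Os z x]].

Definition qclosed (U : finType) (Os : {set {set U}}) (X : {set U}) : Prop :=
  forall x y : U, x \in X -> qle Os y x -> y \in X.

Definition closest (U : finType) (Os : {set {set U}}) (x : U) (Y : {set U}) :
    {set U} :=
  [set x' in Y | ~~ [exists x'' in Y, dist Os x x'' \proper dist Os x x']].

Definition local_lt (U : finType) (Os : {set {set U}}) (X Y : {set U}) : Prop :=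
  (forall x y : U, x \in X -> y \in closest Os x Y -> qlt Os x y) /\
  (forall y x : U, y \in Y -> x \in closest Os y X -> qlt Os x y).

(* The intersection over an empty [F i] is the whole of [U]. *)
Definition union_of_inters (U : finType) (Os : {set {set U}}) (X : {set U}) :
    Prop :=
  exists (I : Type) (F : I -> {set {set U}}),
    (forall i : I, F i \subset Os) /\
    (forall x : U, x \in X <-> exists i : I, x \in \bigcap_(A in F i) A).

Definition in_D (U : finType) (Os : {set {set U}}) (X : {set U}) : Prop :=
  forall (Os' : {set {set U}}) (delta : {set U} -> bool) (m m' : U),
    Os' \subset Os -> models Os' delta m -> models Os' delta m' ->
    m \in X -> m' \notin X ->
    exists m'' : U, [/\ m'' \in X, models Os' delta m'' & qlt Os m'' m'].

Definition neighbourhood (U : finType) (Os : {set {set U}}) (B Y : {set U}) :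
    Prop :=
  B \subset Y /\
  (forall y x : U, y \in Y -> x \in closest Os y B ->
     between Os x y \subset Y).

Definition improving_neighbourhood (U : finType) (Os : {set {set U}})
    (B Y : {set U}) : Prop :=
  B \subset Y /\
  (forall y x : U, y \in Y ->
     x \in closest Os y [set x' in B | qle Os x' y] ->
     between Os x y \subset Y).

(* Main.v *)
Require Import Defs.
From mathcomp Require Import all_boot.

Set Implicit Arguments.
Unset Strict Implicit.
Unset Printing Implicit Defensive.

(** Independence makes every set of obligations the exact set of obligations met
    by some point; in particular the best elements are those meeting all of
    them. Points realizing [obl x :&: obl y] or [obl x :|: obl y] are then
    compared with a closest point: replacing [y] by such a point shrinks the
    distance to [x], so minimality forces [x] and [y] to be comparable. *)

Lemma mem_obl (U : finType) (Os : {set {set U}}) (x : U) (A : {set U}) :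
  (A \in obl Os x) = (A \in Os) && (x \in A).
Proof. by rewrite inE. Qed.

Lemma mem_dist (U : finType) (Os : {set {set U}}) (x y : U) (A : {set U}) :
  (A \in dist Os x y) = ((A \in obl Os x) != (A \in obl Os y)).
Proof. by rewrite !in_setU !in_setD; do 2!case: (A \in obl _ _). Qed.

Lemma obl_sub (U : finType) (Os : {set {set U}}) (x : U) : obl Os x \subset Os.
Proof. by apply/subsetP => A; rewrite mem_obl => /andP[]. Qed.

Lemma independent_obl (U : finType) (Os S : {set {set U}}) :
  independent Os -> S \subset Os -> exists w : U, obl Os w = S.
Proof.
move=> Hindep /subsetP sSO; have [w wS] := Hindep [in S].
exists w; apply/setP => A; rewrite mem_obl.
have [AO | nAO] := boolP (A \in Os).
  by have [h1 h2] := wS A AO; apply/idP/idP.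
by apply/esym/negbTE; apply: contra nAO => /sSO.
Qed.

Lemma best_obl (U : finType) (Os : {set {set U}}) (x : U) :
  independent Os -> x \in best Os -> obl Os x = Os.
Proof.
move=> Hindep; rewrite inE => /existsPn xb.
have [w Ow] := independent_obl Hindep (subxx Os).
have := xb w; rewrite /qlt Ow properEneq obl_sub andbT negbK.
exact: eqP.
Qed.

(** Closest means minimal for inclusion, so it only rules out strictly smaller distances; a
    competitor whose distance is comparable must tie. *)
Lemma closest_dist (U : finType) (Os : {set {set U}}) (Y : {set U}) (x y w : U) :
  y \in closest Os x Y -> w \in Y -> dist Os x w \subset dist Os x y ->
  dist Os x y \subset dist Os x w.
Proof.
rewrite inE => /andP[_ /existsPn ymin] wY sub.
by have := ymin w; rewrite wY properE sub negbK.
Qed.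

(** An obligation met by [y] but missed by [z] would separate [y] from [z], hence also [x] from [y],
    yet [x] meets everything that [y] meets. *)
Lemma between_qle (U : finType) (Os : {set {set U}}) (x y z : U) :
  qle Os x y -> z \in between Os x y -> qle Os z y.
Proof.
move=> /subsetP sub; rewrite inE => /eqP E; apply/subsetP => A Ay.
apply: contraT => nAz; have : A \in dist Os x y.
  by rewrite E in_setU (mem_dist _ z) Ay (negbTE nAz) orbT.
by rewrite mem_dist Ay (sub _ Ay).
Qed.

Lemma qle_qlt (U : finType) (Os : {set {set U}}) (x y : U) :
  qle Os x y -> ~~ qle Os y x -> qlt Os x y.
Proof. by rewrite /qle /qlt properE => -> ->. Qed.

Section Closed.

Variables (U : finType) (Os : {set {set U}}) (X : {set U}).
Hypotheses (Hindep : independent Os) (Hcl : qclosed Os X).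

Lemma qclosed_best (x : U) : X != set0 -> x \in best Os -> x \in X.
Proof.
case/set0Pn => z zX /(best_obl Hindep) Ox.
by apply: (Hcl zX); rewrite /qle Ox obl_sub.
Qed.

(** If [y] were also at least as good as [x], closedness would pull it into [X]. Strictness is thus
    automatic across the boundary of [X]. *)
Lemma qclosed_qlt (x y : U) : x \in X -> y \notin X -> qle Os x y -> qlt Os x y.
Proof. by move=> xX nyX lexy; apply/qle_qlt => //; apply/contra/Hcl: nyX. Qed.

Lemma qclosed_local_lt : local_lt Os X (~: X).
Proof.
split=> [x y xX yc | y x].
- have nyX : y \notin X by move: yc; rewrite inE in_setC => /andP[].
  apply: qclosed_qlt => //.
  (* Meeting only the common obligations makes [w] no better than [y], so [w] stays outside [X]. *)
  have [|w Ow] := independent_obl (S := obl Os x :&: obl Os y) Hindep.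
    by rewrite subIset ?obl_sub.
  have wX : w \in ~: X.
    by rewrite in_setC; apply: contra nyX => /Hcl; apply; rewrite /qle Ow subsetIr.
  have /subsetP sub : dist Os x y \subset dist Os x w.
    apply: (closest_dist yc wX); apply/subsetP => A.
    by rewrite !mem_dist Ow in_setI; do 2!case: (A \in obl _ _).
  (* Such an [A] separates [x] from [y], but neither [x] nor [w] meets it. *)
  apply/subsetP => A Ay; apply: contraT => nAx.
  by have := sub A; rewrite !mem_dist Ow in_setI Ay (negbTE nAx) => /(_ isT).
rewrite in_setC => nyX xc.
have xX : x \in X by move: xc; rewrite inE => /andP[].
apply: qclosed_qlt => //.
(* Dually, the union makes [w] at least as good as [x], so [w] stays in [X] while moving towards
   [y]. *)
have [|w Ow] := independent_obl (S := obl Os x :|: obl Os y) Hindep.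
  by rewrite subUset !obl_sub.
have wX : w \in X by apply: (Hcl xX); rewrite /qle Ow subsetUl.
have /subsetP sub : dist Os y x \subset dist Os y w.
  apply: (closest_dist xc wX); apply/subsetP => A.
  by rewrite !mem_dist Ow in_setU; do 2!case: (A \in obl _ _).
apply/subsetP => A Ay; apply: contraT => nAx.
by have := sub A; rewrite !mem_dist Ow in_setU Ay (negbTE nAx) => /(_ isT).
Qed.

(** The intersection of [obl Os x] is the cone of points at least as good as [x]; a closed set is
    the union of the cones of its points. *)
Lemma qclosed_union_of_inters : union_of_inters Os X.
Proof.
exists {x | x \in X}, (fun x => obl Os (val x)).
split=> [x | x]; first exact: obl_sub.
split=> [xX | [[z zX] /= /bigcapP xz]].
  by exists (exist _ x xX); apply/bigcapP => A; rewrite mem_obl => /andP[].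
apply: (Hcl zX); apply/subsetP => A Az.
by rewrite mem_obl (subsetP (obl_sub _ _) _ Az) xz.
Qed.

Lemma qclosed_in_D : in_D Os X.
Proof.
move=> Os' delta m m' /subsetP sOs mD m'D mX nm'X.
have [|w Ow] := independent_obl (S := obl Os m :|: obl Os m') Hindep.
  by rewrite subUset !obl_sub.
have wX : w \in X by apply: (Hcl mX); rewrite /qle Ow subsetUl.
exists w; split=> //; last by apply: qclosed_qlt; rewrite // /qle Ow subsetUr.
move=> A AO'; have AO := sOs A AO'.
(* On [Os'] both [m] and [m'] follow [delta], so the union of their obligations does too. *)
have -> : (w \in A) = (m \in A) || (m' \in A).
  by move/setP/(_ A): Ow; rewrite in_setU !mem_obl AO.
split=> [/orP[/(mD A AO') | /(m'D A AO')] // | dA].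
by rewrite (proj2 (mD A AO') dA).
Qed.

(** A best [x] is at least as good as [y], so the whole interval is at least as good as [y]. Both
    neighbourhood properties reduce to this. *)
Lemma qclosed_between_best (x y : U) :
  x \in best Os -> y \in X -> between Os x y \subset X.
Proof.
move=> /(best_obl Hindep) Ox yX; apply/subsetP => z.
by move/between_qle => lezy; apply/(Hcl yX)/lezy; rewrite /qle Ox obl_sub.
Qed.

Lemma qclosed_neighbourhood : X != set0 -> neighbourhood Os (best Os) X.
Proof.
move=> Xn0; split; first by apply/subsetP => x; apply: qclosed_best.
move=> y x yX; rewrite inE => /andP[xb _].
exact: qclosed_between_best.
Qed.

Lemma qclosed_improving_neighbourhood :
  X != set0 -> improving_neighbourhood Os (best Os) X.
Proof.
move=> Xn0; split; first by apply/subsetP => x; apply: qclosed_best.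
move=> y x yX; rewrite 2!inE => /andP[/andP[xb _] _].
exact: qclosed_between_best.
Qed.

End Closed.

Theorem fact4p3 (U : finType) (Os : {set {set U}}) (X : {set U})
    (Hindep : independent Os) (Hne : X != set0) (Hcl : qclosed Os X) :
  (forall x : U, x \in best Os -> x \in X) /\
  local_lt Os X (~: X) /\
  union_of_inters Os X /\
  in_D Os X /\
  (neighbourhood Os (best Os) X /\ improving_neighbourhood Os (best Os) X).
Proof.
split; first by move=> x; apply: qclosed_best.
split; first exact: qclosed_local_lt.
split; first exact: qclosed_union_of_inters.
split; first exact: qclosed_in_D.
split; first exact: qclosed_neighbourhood.
exact: qclosed_improving_neighbourhood.
Qed.
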